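(* Let $A$ be a finite nonempty alphabet, let $S\subset A^*$ be an acyclic set and let $X\subset S$ be a bifix code. Then the submonoid $X^*$ is saturated in $S$, that is, $X^*\cap S=\langle X\rangle\cap S$, where $\langle X\rangle$ is the subgroup of the free group $F_A$ generated by $X$.
   Context: A set $S\subset A^*$ is factorial if it contains all factors of its elements. For $w\in S$: $L(w)=\{a\in A\mid aw\in S\}$, $R(w)=\{a\in A\mid wa\in S\}$, $E(w)=\{(a,b)\in A\times A\mid awb\in S\}$. $S$ is biextendable if it is factorial and $E(w)\ne\emptyset$ for all $w\in S$. The extension graph of $w$ is the undirected bipartite graph with vertex set the disjoint union of $L(w)$ and $R(w)$ and an edge between $a\in L(w)$ and $b\in R(w)$ for each $(a,b)\in E(w)$. $S$ is acyclic if it is biextendable and every extension graph of a word of $S$ is acyclic. A bifix code is a set of nonempty words containing no proper prefix and no proper suffix of any of its elements. $A^*$ is viewed inside the free group $F_A$. *)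

(* Defs.v *)
From HB Require Import structures.
From mathcomp Require Import all_boot.
From mathcomp Require Import boolp classical_sets.

Set Implicit Arguments.
Unset Strict Implicit.
Unset Printing Implicit Defensive.

Local Open Scope classical_set_scope.

(* The free group F_A, realised as the set of reduced words over A and its    *)
(* formal inverses: (a, true) stands for a and (a, false) for a^-1.           *)
Section FreeGroup.
Variable A : choiceType.
Implicit Types (x y : A * bool) (u v w : seq (A * bool)).

Definition letter_inv x : A * bool := (x.1, ~~ x.2).

Definition reduced w := sorted (fun x y => y != letter_inv x) w.

Record free_group :=
  FreeGroup { fg_val : seq (A * bool); fg_valP : reduced fg_val }.

HB.instance Definition _ := [isSub for fg_val].
HB.instance Definition _ := [Choice of free_group by <:].

Definition red_cons x w :=
  if w is y :: w' then if y == letter_inv x then w' else x :: w else [:: x].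

Definition red_cat u v := foldr red_cons v u.

Definition word_inv w := rev (map letter_inv w).

Lemma letter_invK : involutive letter_inv.
Proof. by case=> a b; rewrite /letter_inv /= negbK. Qed.

Lemma reduced_behead x w : reduced (x :: w) -> reduced w.
Proof. exact: path_sorted. Qed.

Lemma red_cons_reduced x w : reduced w -> reduced (red_cons x w).
Proof.
case: w => [//|y w] rw /=; case: ifPn => [_|yx]; first exact: reduced_behead rw.
by rewrite /reduced /= yx.
Qed.

Lemma red_consE x w : reduced (x :: w) -> red_cons x w = x :: w.
Proof. by case: w => [//|y w] /= /andP[/negPf ->]. Qed.

Lemma red_consK x w : reduced w -> red_cons (letter_inv x) (red_cons x w) = w.
Proof.
case: w => [_|y w rw] /=; first by rewrite letter_invK eqxx.
case: eqP => [yx|_] /=; last by rewrite letter_invK eqxx.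
by rewrite -yx red_consE.
Qed.

Lemma red_consVK x w : reduced w -> red_cons x (red_cons (letter_inv x) w) = w.
Proof. by move=> rw; rewrite -{1}[x]letter_invK red_consK. Qed.

Lemma red_cat_reduced u v : reduced v -> reduced (red_cat u v).
Proof. by move=> rv; elim: u => //= x u; exact: red_cons_reduced. Qed.

Lemma red_cat_red_cons x v w : reduced w ->
  red_cat (red_cons x v) w = red_cons x (red_cat v w).
Proof.
move=> rw; case: v => [//|y v] /=; case: eqP => [->|//].
by rewrite red_consVK //; exact: red_cat_reduced.
Qed.

Lemma red_catA u v w : reduced w ->
  red_cat u (red_cat v w) = red_cat (red_cat u v) w.
Proof.
by move=> rw; elim: u => //= x u ->; rewrite red_cat_red_cons.
Qed.

Lemma red_cats0 w : reduced w -> red_cat w [::] = w.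
Proof.
elim: w => //= x w IH rw.
by rewrite IH ?red_consE //; exact: reduced_behead rw.
Qed.

Lemma word_inv_reduced w : reduced w -> reduced (word_inv w).
Proof.
rewrite /reduced /word_inv rev_sorted sorted_map.
apply: sub_sorted => x y /=; apply: contra => /eqP ->.
by rewrite letter_invK eqxx.
Qed.

Lemma red_catVs w : reduced w -> red_cat (word_inv w) w = [::].
Proof.
elim: w => // x w IH rw; have rw' := reduced_behead rw.
rewrite /word_inv /= rev_cons /red_cat foldr_rcons -(red_consE rw).
by rewrite red_consK //; exact: IH.
Qed.

Lemma word_invK : involutive word_inv.
Proof. by move=> w; rewrite /word_inv map_rev revK mapK //; exact: letter_invK. Qed.

Definition fg_one := @FreeGroup [::] isT.
Definition fg_mul (g h : free_group) : free_group :=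
  FreeGroup (red_cat_reduced (fg_val g) (fg_valP h)).
Definition fg_inv (g : free_group) : free_group :=
  FreeGroup (word_inv_reduced (fg_valP g)).

Lemma fg_mulA : associative fg_mul.
Proof. by move=> g h k; apply: val_inj; rewrite /= red_catA //; exact: fg_valP. Qed.

Lemma fg_mul1 : left_id fg_one fg_mul.
Proof. by move=> g; exact: val_inj. Qed.

Lemma fg_mulr1 : right_id fg_one fg_mul.
Proof. by move=> g; apply: val_inj; rewrite /= red_cats0 //; exact: fg_valP. Qed.

Lemma fg_mulV : left_inverse fg_one fg_inv fg_mul.
Proof. by move=> g; apply: val_inj; rewrite /= red_catVs //; exact: fg_valP. Qed.

Lemma fg_mulrV : right_inverse fg_one fg_inv fg_mul.
Proof.
move=> g; apply: val_inj => /=; rewrite -{1}[fg_val g]word_invK red_catVs //.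
exact: word_inv_reduced (fg_valP g).
Qed.

HB.instance Definition _ :=
  isGroup.Build free_group fg_mulA fg_mul1 fg_mulr1 fg_mulV fg_mulrV.

Definition fg_gen (a : A) : free_group := @FreeGroup [:: (a, true)] isT.

(* The inclusion of A^* in F_A. *)
Definition fg_word (w : seq A) : free_group := (\prod_(a <- w) fg_gen a)%g.

Lemma fg_word_val (w : seq A) : fg_val (fg_word w) = [seq (a, true) | a <- w].
Proof.
rewrite /fg_word; elim: w => [|a w IH]; first by rewrite big_nil.
by rewrite big_cons /= IH; case: w {IH} => //= b w; rewrite /letter_inv xpair_eqE andbF.
Qed.

Lemma fg_word_inj : injective fg_word.
Proof.
move=> u v /(congr1 fg_val); rewrite !fg_word_val.
by apply: inj_map => a b [].
Qed.

Lemma fg_word_cat (u v : seq A) : fg_word (u ++ v) = (fg_word u * fg_word v)%g.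
Proof. exact: big_cat. Qed.

End FreeGroup.

Definition is_subgroup (G : groupType) (H : set G) : Prop :=
  [/\ H 1%g,
      (forall g h, H g -> H h -> H (g * h)%g)
    & (forall g, H g -> H (g^-1)%g)].

Definition generated_subgroup (G : groupType) (Y : set G) : set G :=
  smallest (@is_subgroup G) Y.

Section Words.
Variable A : choiceType.
Implicit Types (S X : set (seq A)) (u v w : seq A) (a b : A).

Definition factorial_set S : Prop := forall u v w, S (u ++ v ++ w) -> S v.

Definition lext S w : set A := [set a | S (a :: w)].
Definition rext S w : set A := [set a | S (rcons w a)].
Definition bext S w : set (A * A) := [set ab | S (ab.1 :: rcons w ab.2)].

Definition biextendable S : Prop :=
  factorial_set S /\ forall w, S w -> bext S w !=set0.

(* inl and inr tag the two sides L(w) and R(w) of the bipartite graph. *)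
Definition ext_vertex S w : set (A + A) :=
  (inl @` lext S w) `|` (inr @` rext S w).

Definition ext_edge S w : rel (A + A) := fun x y =>
  match x, y with
  | inl a, inr b | inr b, inl a => `[< bext S w (a, b) >]
  | _, _ => false
  end.

(* The simple graph with vertex set V and adjacency e, e being symmetric and  *)
(* irreflexive. Without the bound on the size of c, going back and forth      *)
(* along one edge would count as a cycle.                                     *)
Definition acyclic_graph (T : eqType) (V : set T) (e : rel T) : Prop :=
  forall c : seq T, (forall x, x \in c -> V x) ->
    2 < size c -> uniq c -> ~~ cycle e c.

Definition acyclic_set S : Prop :=
  biextendable S /\
  forall w, S w -> acyclic_graph (ext_vertex S w) (ext_edge S w).

Definition bifix_code X : Prop :=
  [/\ (forall w, X w -> w <> [::]),
      (forall u v, X u -> X v -> prefix u v -> u = v)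
    & (forall u v, X u -> X v -> suffix u v -> u = v)].

(* X^*, the submonoid of A^* generated by X. *)
Definition star X : set (seq A) :=
  [set flatten us | us in [set us : seq (seq A) | forall u, u \in us -> X u]].

(* <X>, intersected with A^*. *)
Definition subgroup_words X : set (seq A) :=
  @fg_word A @^-1` generated_subgroup (@fg_word A @` X).

Definition saturated_in S X : Prop :=
  star X `&` S = subgroup_words X `&` S.

End Words.

(* Main.v *)
(* Call w-cycle a cycle u_1, v_1, u_2, v_2, ... with all u_i w v_i and        *)
(* u_(i+1) w v_i in S. By induction on the total length, in an acyclic set S  *)
(* there is no w-cycle whose u_i form a suffix code and whose v_i form a      *)
(* prefix code. Hence every simple path of the incidence graph of X (p and q  *)
(* are joined when pq is in X) runs through a suffix code and a prefix code,  *)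
(* as a shortest counterexample would close up into such a cycle. It follows  *)
(* that identifying the prefixes of X that are connected in this graph, and   *)
(* the words of X with the empty word, turns the prefix tree of X into an     *)
(* automaton that is both deterministic and codeterministic: it is already    *)
(* folded in the sense of Stallings, so every element of <X> labels a loop at *)
(* the initial state. Finally a loop labelled by a positive word w of S can   *)
(* be followed along prefixes of X only, again since no cycle arises, so that *)
(* w lies in X^*.                                                             *)
Require Import Defs.
From mathcomp Require Import all_boot.
From mathcomp Require Import boolp classical_sets.
Local Open Scope classical_set_scope.

Set Implicit Arguments.
Unset Strict Implicit.
Unset Printing Implicit Defensive.

(** The core is [antichain_acyclic]: acyclicity of the one-letter extension graphs propagates to
    contexts of any length that form a suffix code on the left and a prefix code on the right.
    Through [inc_path_antichain] it controls the simple paths of the incidence graph of X, which can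
    then be moved one letter across the cut ([conn_shift]). This makes the automaton deterministic
    ([eqst_rcons]) and codeterministic ([eqst_rcons_inv]), whence [run_generated]. Acyclicity of S
    serves once more in [eqst_extend], which keeps a positive run on genuine prefixes of X, so that
    [run_star] can read off a factorization over X. *)

(** * Excursions in a list *)

Lemma has_split (T : Type) (I : pred T) (s : seq T) : has I s ->
  exists l x r, [/\ s = l ++ x :: r, I x & ~~ has I l].
Proof.
by case/split_find=> x s1 s2 Ix nI; exists s1, x, s2; rewrite cat_rcons.
Qed.

(** Going backwards and forwards from [y], take the first elements met that satisfy [I]. *)
Lemma pinch_seq (T : eqType) (I : pred T) (x y : T) (s : seq T) :
  I x -> I (last x s) -> y \in s -> ~~ I y ->
  exists l x' m x'' r, [/\ x :: s = l ++ x' :: m ++ x'' :: r, I x', I x'',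
    ~~ has I m & y \in m].
Proof.
move=> Ix Il ys nIy; case/splitPr: ys Il => s1 s2; rewrite last_cat /= => Il.
have hl : has I (rev (x :: s1)) by rewrite has_rev /= Ix.
have hr : has I s2.
  apply/hasP; exists (last y s2) => //; move: (mem_last y s2).
  by rewrite inE => /predU1P[e|//]; rewrite e (negbTE nIy) in Il.
have [l [x' [r [e Ix' nl]]]] := has_split hl.
have [l' [x'' [r' [e' Ix'' nl']]]] := has_split hr.
exists (rev r), x', (rev l ++ y :: l'), x'', r'.
split=> //; last by rewrite mem_cat mem_head orbT.
  have E : x :: s1 = rev r ++ x' :: rev l.
    by rewrite -[LHS]revK e rev_cat rev_cons cat_rcons.
  by rewrite -cat_cons E e' -!catA.
by rewrite has_cat has_rev /= (negbTE nl) (negbTE nIy) (negbTE nl').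
Qed.

(** * Extension graphs with contexts of arbitrary length *)

Section ExtensionGraphs.
Variable A : choiceType.
Implicit Types (S X Y : set (seq A)) (u v w : seq A) (a : A).

(* (true, u) is the left context rev u and (false, v) is the right context v; *)
(* storing left contexts reversed makes a shorter context a prefix on both    *)
(* sides. *)
Local Notation context := (bool * seq A)%type.
Implicit Types (x y z : context) (c s : seq context).

Definition glue w x y : seq A :=
  if x.1 then rev x.2 ++ w ++ y.2 else rev y.2 ++ w ++ x.2.

(** On one-letter contexts with [Y] = S this is the extension graph of [w]. *)
Definition gext Y w : rel context :=
  fun x y => (x.1 != y.1) && `[< Y (glue w x y) >].

Definition trunc x y := (x.1 == y.1) && prefix x.2 y.2.

(** In terms of words: the left contexts form a suffix code, the right contexts a prefix code. *)
Definition antichain c := {in c &, forall x y, trunc x y -> x = y}.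

Lemma gext_sym Y w : symmetric (gext Y w).
Proof.
move=> [b u] [b' v]; rewrite /gext /glue /= eq_sym.
by case: b b' => [] [].
Qed.

Lemma gext_side Y w x y : gext Y w x y -> x.1 = ~~ y.1.
Proof. by case/andP; case: x.1 y.1 => [] []. Qed.

Lemma trunc_refl x : trunc x x.
Proof. by rewrite /trunc eqxx prefix_refl. Qed.

Lemma trunc_side x y : trunc x y -> x.1 = y.1.
Proof. by case/andP=> /eqP. Qed.

Lemma trunc_trans : transitive trunc.
Proof.
move=> y x z /andP[/eqP xy pxy] /andP[yz pyz].
by rewrite /trunc xy yz (prefix_trans pxy pyz).
Qed.

Lemma antichain_sub c c' : {subset c' <= c} -> antichain c -> antichain c'.
Proof. by move=> sc ac x y /sc xc /sc yc; exact: ac. Qed.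

Lemma gext_trunc S w x x' y : factorial_set S ->
  trunc x' x -> gext S w x y -> gext S w x' y.
Proof.
move=> fS; case: x x' y => [b u] [b' u'] [d v] /andP[/= /eqP -> /prefixP[t ->]].
rewrite /gext /glue /= => /andP[-> /asboolP H]; apply/asboolP; case: b H => H.
  by apply: (fS (rev t) _ [::]); rewrite cats0 catA -rev_cat.
by apply: (fS [::] _ t); rewrite /= -!catA.
Qed.

(** By [gext_trunc], [z] may replace both ends of an excursion [m] away from the contexts extending
    [z], which closes [m] into a cycle. The discarded vertex [x'] is kept in the statement to
    compare lengths later. *)
Lemma pinch S w z x y s : factorial_set S -> path (gext S w) x s ->
  trunc z x -> trunc z (last x s) -> y \in s -> z.1 = y.1 -> ~~ trunc z y ->
  exists x' m, [/\ subseq (x' :: m) (belast x s), trunc z x',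
    ~~ has (trunc z) m, 1 < size m & cycle (gext S w) (z :: m)].
Proof.
move=> fS ps zx zl ys sy nzy.
have [l [x' [m [x'' [r [e zx' zx'' nm ym]]]]]] := pinch_seq zx zl ys nzy.
have pm : path (gext S w) x' (m ++ [:: x'']).
  case: l e => [|x0 l] [e es]; move: ps; rewrite es.
    by rewrite e -cat_rcons -cats1 cat_path => /andP[].
  rewrite cat_path /= => /and3P[_ _].
  by rewrite -cat_rcons -cats1 cat_path => /andP[].
have {pm} cm : cycle (gext S w) (z :: m).
  move: pm; rewrite /= -cats1; case: m {e nm} ym => [//|y0 m] _ /=.
  rewrite !cat_path /= !andbT => /and3P[x'y -> lx] /=.
  rewrite (gext_trunc fS zx') //= gext_sym; apply: gext_trunc fS zx'' _.
  by rewrite gext_sym.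
exists x', m; split=> //.
  move: e; rewrite lastI [x'' :: r]lastI -rcons_cat -rcons_cons -rcons_cat.
  move=> /rcons_inj[-> _]; rewrite -cat_cons.
  exact: subseq_trans (prefix_subseq _ _) (suffix_subseq _ _).
(* [y] is on the side of [z], hence not adjacent to it, so [m] is not [y] alone. *)
case: m ym cm {e nm} => [//|y0 [|//]]; rewrite inE => /eqP <- /= /andP[].
by move=> /gext_side; rewrite sy; case: y.1.
Qed.

(** * No cycle through an antichain *)

Definition strip b x : context := if x.1 == b then (x.1, behead x.2) else x.

Definition letter_context (t : A + A) : context :=
  match t with inl a => (true, [:: a]) | inr a => (false, [:: a]) end.

Lemma acyclic_letters S w (c : seq (A + A)) : acyclic_set S ->
  cycle (gext S w) (map letter_context c) -> uniq c -> 2 < size c -> False.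
Proof.
move=> [[fS _] aS] cyc uc sc.
have {}cyc : cycle (ext_edge S w) c.
  rewrite (mono_cycle (e := ext_edge S w)) in cyc; first exact: cyc.
  by case=> a [] b; rewrite /gext /glue /bext //= cats1.
have Hw : S w.
  case: c cyc {uc} sc => [//|x [|y c]] //= /andP[+ _] _.
  by case: x => a; case: y => b //= /asboolP; rewrite /bext /= -cats1;
    exact: (fS [:: _] w [:: _]).
have := aS w Hw c _ sc uc; rewrite cyc => /(_ _)/negP; case=> // x xc.
have := next_cycle cyc xc; case: x {xc} => a; case: (next _ _) => b //= /asboolP.
  rewrite /bext /= => H; left; exists a => //.
  by apply: (fS [::] _ [:: b]); rewrite /= cats1.
rewrite /bext /= => H; right; exists a => //.
by apply: (fS [:: b] _ [::]); rewrite /= cats0.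
Qed.

(** An empty context truncates every context on its side, and the vertex two steps further along the
    cycle is a different one on that side. *)
Lemma antichain_nonempty S w c : cycle (gext S w) c -> uniq c -> 2 < size c ->
  antichain c -> {in c, forall x, x.2 != [::]}.
Proof.
move=> cyc uc sc ac x xc; apply/eqP => x0.
case: (rot_to xc) => i [|y1 [|y s]] e; move: sc; rewrite -(size_rot i) e //= => _.
have mc : rot i c =i c := mem_rot i c.
have yc : y \in c by rewrite -mc e !inE eqxx !orbT.
move: cyc uc; rewrite -(rot_cycle i) -(rot_uniq i) e /=.
move=> /and3P[/gext_side e1 /gext_side e2 _].
rewrite !inE !negb_or => /andP[/and3P[_ /eqP xy _] _]; apply: xy.
by apply: ac; rewrite // /trunc x0 prefix0s e1 e2 negbK eqxx.
Qed.

Lemma trunc_letterP b a x :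
  reflect (exists u, x = (b, a :: u)) (trunc (b, [:: a]) x).
Proof.
apply: (iffP idP) => [|[u ->]]; last first.
  by rewrite /trunc prefix_cons /= prefix0s !eqxx.
case: x => d [|a' u]; rewrite /trunc /= ?andbF // => /and3P[/eqP <- /eqP <- _].
by exists u.
Qed.

Lemma gext_strip S w b a x y :
  (x.1 = b -> trunc (b, [:: a]) x) -> (y.1 = b -> trunc (b, [:: a]) y) ->
  gext S w x y ->
  gext S (if b then a :: w else rcons w a) (strip b x) (strip b y).
Proof.
case: x y => [d u] [d' v] /= hx hy /andP[/= dd' /asboolP H].
have {hx hy} [[/trunc_letterP[t [? ?]] eb]|[/trunc_letterP[t [? ?]] eb]] :
    (trunc (b, [:: a]) (d, u) /\ d' = ~~ b) \/ (trunc (b, [:: a]) (d', v) /\ d = ~~ b).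
  by case: b d d' dd' hx hy {H} => [] [] [] // _ hx hy; auto.
all: subst; clear dd'; move: H; rewrite /gext /strip /glue; case: b => /=.
all: by rewrite ?rev_cons -?cats1 -?catA => H; apply/asboolP.
Qed.

(* A cycle is shortened in one of two ways. Pick a vertex x0 of length at     *)
(* least two with central letter a. Either all the vertices on that side have *)
(* central letter a, and it can be moved into w; or the cycle enters and      *)
(* leaves these vertices, and an excursion outside of them closes up into a   *)
(* smaller cycle through the single letter a. *)
Lemma antichain_acyclic S w c : acyclic_set S -> cycle (gext S w) c ->
  uniq c -> 2 < size c -> antichain c -> False.
Proof.
move=> aS; have fS : factorial_set S by case: aS => [[]].
have [n] := ubnP (\sum_(x <- c) size x.2).
elim: n w c => [//|n IH] w c ln cyc uc sc ac.
rewrite ltnS in ln; have ne := antichain_nonempty cyc uc sc ac.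
have [lt|] := boolP (all (fun x => size x.2 == 1) c).
  have [c0 e] : exists c0 : seq (A + A), c = map letter_context c0.
    elim: c lt {ln cyc uc sc ac ne} => [|[b [|a [|//]]] c IHc] //=.
      by exists [::].
    by case/IHc=> c0 ->; exists ((if b then inl a else inr a) :: c0); case: b.
  apply: (acyclic_letters (S := S) (w := w) (c := c0)) => //; rewrite -?e //.
    by move: uc; rewrite e => /map_uniq.
  by move: sc; rewrite e size_map.
case/allPn=> -[b [|a u]] xc su; first by have := ne _ xc.
pose z := (b, [:: a]).
have zx : trunc z (b, a :: u) by apply/trunc_letterP; exists u.
(* Otherwise [x] is [z], which properly truncates the chosen vertex. *)
have sz x : x \in c -> trunc z x -> 1 < size x.2.
  move=> xc' /trunc_letterP[[|a' v] e]; last by rewrite e.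
  by move: su; rewrite e in xc' *; have [<-] := ac _ _ xc' xc zx.
have [al|] := boolP (all (fun x => (x.1 == b) ==> trunc z x) c).
  have hz x : x \in c -> x.1 = b -> trunc z x.
    by move=> /(allP al); case: eqP => // _ + _.
  have stripT x y : x \in c -> y \in c -> trunc (strip b x) (strip b y) -> trunc x y.
    move=> /hz hx /hz hy; rewrite {1}/trunc /strip.
    case: (x.1 =P b) hx => [xb /(_ xb) /trunc_letterP[v ->]|nx _];
      case: (y.1 =P b) hy => [yb /(_ yb) /trunc_letterP[v' ->]|ny _] //=.
    - by rewrite /trunc prefix_cons /= !eqxx.
    - by case/andP=> /eqP/esym.
    - by case/andP=> /eqP.
  have stripI : {in c &, injective (strip b)}.
    move=> x y xc' yc e; apply: ac => //; apply: stripT => //.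
    by rewrite e trunc_refl.
  apply: (IH (if b then a :: w else rcons w a) (map (strip b) c)).
  - apply: leq_trans ln; rewrite big_map.
    rewrite (big_rem (b, a :: u)) //= [ltnRHS](big_rem (b, a :: u)) //= -addSn.
    by apply: leq_add; [rewrite /strip /= eqxx | apply: leq_sum => x _; rewrite /strip;
      case: eqP => //= _; rewrite size_behead leq_pred].
  - apply: (homo_cycle_in (P := mem c) (e := gext S w)) _ cyc; last exact/allP.
    by move=> x y xc' yc; apply: gext_strip; apply: hz.
  - by rewrite map_inj_in_uniq.
  - by rewrite size_map.
  - move=> _ _ /mapP[x xc' ->] /mapP[y yc ->] /(stripT _ _ xc' yc).
    by move/(ac _ _ xc' yc) => ->.
case/allPn=> y yc; rewrite negb_imply => /andP[/eqP yb nzy].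
case: (rot_to xc) => i s e.
have mc : rot i c =i c := mem_rot i c.
have ps : path (gext S w) (b, a :: u) (rcons s (b, a :: u)).
  by move: cyc; rewrite -(rot_cycle i) e.
have [||||x' [m [sub zx' nm sm cm]]] := pinch (z := z) (y := y) fS ps zx.
- by rewrite last_rcons.
- by rewrite -rot1_cons mem_rot -e mc.
- by [].
- by [].
have {}sub : subseq (x' :: m) (rot i c) by move: sub; rewrite belast_rcons e.
have um : uniq (x' :: m) by apply: subseq_uniq sub _; rewrite rot_uniq.
have mem_m t : t \in x' :: m -> t \in c by move/(mem_subseq sub); rewrite mc.
have nzm t : t \in m -> ~~ trunc z t.
  by move=> tm; apply: contra nm => ?; apply/hasP; exists t.
apply: (IH w (z :: m)) => //.
- apply: leq_trans ln; rewrite big_cons.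
  (* The length drops: [z] has length 1 and replaces [x'], of length at least 2. *)
  apply: (@leq_trans (\sum_(t <- x' :: m) size t.2)).
    by rewrite big_cons ltn_add2r sz // mem_m // mem_head.
  by apply: uniq_sub_le_big => // *; rewrite leq_addr.
- apply/andP; split; last by case/andP: um.
  by apply/negP => /nzm; rewrite trunc_refl.
- move=> p q; rewrite !inE => /predU1P[->|pm] /predU1P[->|qm] //.
  + by move=> h; have := nzm _ qm; rewrite h.
  (* A truncation of [z] also truncates [x'], which lies in the antichain [c]. *)
  + move=> h; have := ac p x' (mem_m _ _) (mem_m _ _) (trunc_trans h zx').
    rewrite inE pm orbT mem_head => /(_ isT isT) e'.
    by move: um; rewrite -e' /= pm.
  + by apply: ac; apply: mem_m; rewrite inE ?pm ?qm orbT.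
Qed.

(** An excursion would close up through [(b, [:: a])] into a cycle forbidden by [antichain_acyclic].
    The ends [x] and [l] need not belong to the antichain. *)
Lemma no_excursion S w b a x t l : acyclic_set S ->
  path (gext S w) x (rcons t l) -> trunc (b, [:: a]) x -> trunc (b, [:: a]) l ->
  uniq t -> antichain t -> {in t, forall y, y.2 != [::]} ->
  {in t, forall y, y.1 = b -> trunc (b, [:: a]) y}.
Proof.
move=> aS ps zx zl ut act ne y yt yb; apply: contraT => nzy.
have fS : factorial_set S by case: aS => [[]].
have [||||x' [m [sub _ nm sm cm]]] := pinch (y := y) fS ps zx.
- by rewrite last_rcons.
- by rewrite mem_rcons inE yt orbT.
- by rewrite yb.
- by [].
have {}sub : subseq m t.
  move: sub; rewrite belast_rcons /=; case: eqP => // _.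
  exact: cons_subseq.
have nzm p : p \in m -> ~~ trunc (b, [:: a]) p.
  by move=> pm; apply: contra nm => ?; apply/hasP; exists p.
case: (antichain_acyclic aS cm _ sm).
  by rewrite /= (subseq_uniq sub) // andbT; apply/negP => /nzm; rewrite trunc_refl.
have mt := mem_subseq sub.
move=> p q; rewrite !inE => /predU1P[->|pm] /predU1P[->|qm] //.
- by move=> h; have := nzm _ qm; rewrite h.
- case: p pm => d [|e [|? ?]] pm; rewrite /trunc /= ?andbF //.
    by have := ne _ (mt _ pm).
  by case/and3P=> /eqP -> /eqP ->.
- by apply: act; apply: mt.
Qed.

(** * Simple paths of the incidence graph *)

(* The incidence graph of X, whose isolated vertices include those carrying   *)
(* the empty word. *)
Definition inc X x y := [&& x.2 != [::], y.2 != [::] & gext X [::] x y].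

Lemma inc_sym X : symmetric (inc X).
Proof. by move=> x y; rewrite /inc gext_sym andbCA. Qed.

Lemma inc_nonempty X x s : path (inc X) x s -> s != [::] ->
  {in x :: s, forall y, y.2 != [::]}.
Proof.
case: s => [//|y s] ps _; have : all (fun y => y.2 != [::]) [:: x, y & s].
  elim: s x y ps => [|t s IH] x y /= /andP[/and3P[-> -> _]] //.
  by move=> ps; have := IH y t ps; rewrite /= => /andP[_ ->].
by move/allP.
Qed.

Lemma inc_path_sub S X x s : X `<=` S -> path (inc X) x s ->
  path (gext S [::]) x s.
Proof.
move=> XS; apply: sub_path => p q /and3P[_ _ /andP[pq /asboolP H]].
by rewrite /gext pq; apply/asboolP; apply: XS.
Qed.

Lemma bifix_gext X w x x' y : bifix_code X ->
  gext X w x y -> gext X w x' y -> trunc x x' -> x = x'.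
Proof.
move=> [_ pX sX]; case: x x' y => [b u] [b' u'] [d v].
move=> /andP[/= _ /asboolP H] /andP[/= _ /asboolP H'] /andP[/= /eqP eb /prefixP[t eu]].
move: H H'; rewrite -{}eb {}eu /glue /= => H H'.
suff -> : t = [::] by rewrite cats0.
apply/nilP; rewrite /nilp; case: b H H' => /= H H'.
  have := sX _ _ H H'; rewrite rev_cat -catA suffix_suffix.
  move=> /(_ isT)/(congr1 size)/eqP.
  by rewrite [X in _ == X]size_cat -[X in X == _]add0n eqn_add2r size_rev eq_sym.
have := pX _ _ H H'; rewrite !catA prefix_prefix => /(_ isT)/(congr1 size)/eqP.
by rewrite [X in _ == X]size_cat -[X in X == _]addn0 eqn_add2l eq_sym.
Qed.

Section BifixCode.
Variables (S X : set (seq A)).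
Hypotheses (aS : acyclic_set S) (XS : X `<=` S) (bX : bifix_code X).

(** If [x] truncated [l], putting [x] in place of [l] would close the path into a cycle on [x :: s].
    When [s] is too short for a cycle, the sides or the bifix property give the contradiction. *)
Lemma inc_path_ends x s l : path (inc X) x (rcons s l) -> uniq (x :: rcons s l) ->
  antichain (x :: s) -> ~~ trunc x l.
Proof.
move=> ps us ac; apply/negP => xl; have fS : factorial_set S by case: aS => [[]].
have pS := inc_path_sub XS ps; case: s ps us ac pS => [|y [|y' s]].
- by move=> _ _ _ /=; rewrite andbT => /gext_side; rewrite (trunc_side xl); case: l.1.
- rewrite /= !inE => /and3P[/and3P[_ _ xy] /and3P[_ _ yl] _].
  by rewrite (bifix_gext bX xy _ xl) ?eqxx ?orbT // gext_sym.
move: (y' :: s) (isT : 0 < size (y' :: s)) => {}s s0 _ us ac pS.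
apply: (antichain_acyclic aS _ _ _ ac (w := [::])); last by rewrite /= !ltnS.
  move: pS; rewrite /= !rcons_path => /and3P[-> -> /=].
  by rewrite ![gext _ _ (last _ _) _]gext_sym; exact: gext_trunc.
by move: us; rewrite -rcons_cons rcons_uniq => /andP[].
Qed.

(** By induction the path without either end is an antichain; the two ends are compared by
    [inc_path_ends], applied in both directions. *)
Lemma inc_path_antichain x s : path (inc X) x s -> uniq (x :: s) ->
  antichain (x :: s).
Proof.
have [n] := ubnP (size s); elim: n x s => [//|n IH] x s ln ps us.
case/lastP: s ln ps us => [|s l] ln ps us.
  by move=> p q; rewrite !inE => /eqP -> /eqP ->.
rewrite size_rcons ltnS in ln.
have ac1 : antichain (x :: s).
  apply: IH => //; first by move: ps; rewrite rcons_path => /andP[].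
  by move: us; rewrite -rcons_cons rcons_uniq => /andP[].
have ac2 : antichain (l :: rev s).
  apply: (@antichain_sub (rcons s l)) => [t|]; first by rewrite mem_rcons !inE mem_rev.
  case: s ln ps us {ac1} => [|y s] ln /= /andP[_ ps] /andP[_ us];
    last by apply: IH; rewrite ?size_rcons.
  by move=> p q; rewrite !inE => /eqP -> /eqP ->.
have n1 := inc_path_ends ps us ac1.
have n2 : ~~ trunc l x.
  apply: (@inc_path_ends l (rev s)) => //.
    have := rev_path (inc X) x (rcons s l).
    rewrite last_rcons belast_rcons rev_cons => ->.
    by rewrite (eq_path (fun p q => inc_sym X q p)).
  by rewrite -rev_cons -rev_rcons rev_uniq.
have ac3 : antichain (rcons s l).
  by apply: antichain_sub ac2 => t; rewrite mem_rcons !inE mem_rev.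
move=> p q; rewrite !inE !mem_rcons !inE.
case/predU1P=> [->|pm] /predU1P[->|qm] //.
- case/predU1P: qm => [->|qm]; first by rewrite (negbTE n1).
  by apply: ac1; rewrite inE ?qm ?eqxx ?orbT.
- case/predU1P: pm => [->|pm]; first by rewrite (negbTE n2).
  by apply: ac1; rewrite inE ?pm ?eqxx ?orbT.
- by apply: ac3; rewrite mem_rcons inE.
Qed.

Definition conn x y := exists2 s, path (inc X) x s & last x s = y.

Lemma conn_refl x : conn x x.
Proof. by exists [::]. Qed.

Lemma conn1 x y : inc X x y -> conn x y.
Proof. by exists [:: y]; rewrite /= ?andbT. Qed.

Lemma conn_trans y x z : conn x y -> conn y z -> conn x z.
Proof.
by move=> [s ps <-] [s' ps' <-]; exists (s ++ s'); rewrite ?cat_path ?last_cat ?ps.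
Qed.

Lemma conn_sym x y : conn x y -> conn y x.
Proof.
move=> [s ps <-]; exists (rev (belast x s)).
  by rewrite rev_path (eq_path (fun p q => inc_sym X q p)).
by case: s {ps} => // ? ?; rewrite rev_cons last_rcons.
Qed.

Lemma conn_uniq x y : conn x y ->
  exists s, [/\ path (inc X) x s, uniq (x :: s) & last x s = y].
Proof. by move=> [s /shortenP[s' ps' us' _] e]; exists s'. Qed.

Lemma conn_isolated x y : conn x y -> (forall t, ~~ inc X x t) -> x = y.
Proof. by case=> -[|t s] /= => [_ //|/andP[+ _] _ nx]; rewrite (negbTE (nx t)). Qed.

Lemma inc_path_letter b a x s : path (inc X) x s -> uniq (x :: s) ->
  trunc (b, [:: a]) x -> trunc (b, [:: a]) (last x s) ->
  {in x :: s, forall y, y.1 = b -> trunc (b, [:: a]) y}.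
Proof.
move=> ps us zx zl y ys yb; have ac := inc_path_antichain ps us.
case/lastP: s ps us zl ac ys => [|s l] ps us zl ac ys.
  by move: ys; rewrite inE => /eqP ->.
have ne := inc_nonempty ps; rewrite last_rcons in zl.
move: ys; rewrite inE mem_rcons inE => /or3P[/eqP -> //|/eqP -> //|ys].
have sub : {subset s <= x :: rcons s l}.
  by move=> t ts; rewrite inE mem_rcons inE ts !orbT.
apply: (no_excursion aS (inc_path_sub XS ps) zx zl) yb => //.
- by move: us; rewrite /= rcons_uniq => /and3P[].
- exact: antichain_sub ac.
- by move=> t /sub; apply: ne; rewrite -size_eq0 size_rcons.
Qed.

(** Moves the cut across [a]: the letter leaves the contexts of side [b] and joins those of the
    other side, so glued words do not change. *)
Definition shift b a x : context :=
  if x.1 == b then (x.1, behead x.2) else (x.1, a :: x.2).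

Lemma conn_shift b a x y : conn x y -> x <> y ->
  trunc (b, [:: a]) x -> trunc (b, [:: a]) y ->
  conn (shift b a x) (shift b a y).
Proof.
move=> /conn_uniq[s [ps us <-]] xy zx zl.
have ac := inc_path_antichain ps us; have hl := inc_path_letter ps us zx zl.
exists (map (shift b a) s); last by rewrite last_map.
apply: (homo_path_in (P := mem (x :: s)) (e := inc X)) _ ps; last exact/allP.
(* A vertex equal to [(b, [:: a])] would truncate both ends, hence equal both. *)
have ne p : p \in x :: s -> (shift b a p).2 != [::].
  move=> pm; rewrite /shift; case: (p.1 =P b) => //= pb.
  have /trunc_letterP[[|c v] e] := hl _ pm pb; last by rewrite e.
  case: xy; rewrite -e in zx zl.
  exact: etrans (esym (ac _ _ pm (mem_head _ _) zx)) (ac _ _ pm (mem_last _ _) zl).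
move=> p q pm qm /and3P[_ _ pq]; rewrite /inc !ne //=.
have hp := hl _ pm; have hq := hl _ qm; case: p q {pm qm} pq hp hq => [d u] [d' v].
rewrite /gext /shift /glue /= => /andP[dd' H].
move=> hp hq; have [[/trunc_letterP[t [? ?]] eb]|[/trunc_letterP[t [? ?]] eb]] :
    (trunc (b, [:: a]) (d, u) /\ d' = ~~ b) \/ (trunc (b, [:: a]) (d', v) /\ d = ~~ b).
  by case: b d d' dd' hp hq {H hl ne zx zl} => [] [] [] // _ hx hy; auto.
all: subst; clear dd'; move: H {hp hq hl ne zx zl}; case: b => /=.
all: by rewrite ?rev_cons -?cats1 -?catA.
Qed.

(** * Prefixes of X as states of a folded automaton *)

Definition pre p : context := (true, rev p).

Lemma inc_preE p q :
  inc X (pre p) (false, q) <-> [/\ p <> [::], q <> [::] & X (p ++ q)].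
Proof.
rewrite /inc /gext /glue /= revK -size_eq0 size_rev size_eq0.
by split=> [/and3P[/eqP ? /eqP ? /asboolP]|[/eqP -> /eqP -> ?]] //; apply/asboolP.
Qed.

Lemma bifix_cat p q : X p -> X (p ++ q) -> q = [::].
Proof.
case: bX => _ pX _ Xp Xpq; have := pX _ _ Xp Xpq; rewrite prefix_prefix.
by move=> /(_ isT) /(congr1 (drop (size p))); rewrite drop_size drop_size_cat.
Qed.

(** The words that represent the initial state; they are isolated in the incidence graph. *)
Definition base p := p = [::] \/ X p.

Lemma conn_base p x : base p -> conn (pre p) x -> pre p = x.
Proof.
move=> bp /conn_isolated; apply => -[[] v].
  by rewrite /inc /gext /= !andbF.
apply/negP => /inc_preE[pn vn Xpv]; case: bp => // Xp.
exact/vn/(bifix_cat Xp).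
Qed.

Lemma pre_inj : injective pre.
Proof. by move=> p q [] /(can_inj revK). Qed.

(* The prefixes of X modulo eqst are the states of the coset automaton. *)
Definition eqst p q := base p /\ base q \/ conn (pre p) (pre q).

Lemma eqst_refl p : eqst p p.
Proof. by right; exact: conn_refl. Qed.

Lemma eqst_sym p q : eqst p q -> eqst q p.
Proof. by case=> [[]|/conn_sym]; [left|right]. Qed.

Lemma eqst_trans q p r : eqst p q -> eqst q r -> eqst p r.
Proof.
case=> [[bp bq]|pq] [[bq' br]|qr]; first by left.
- by left; split=> //; rewrite -(pre_inj (conn_base bq qr)).
- by left; split=> //; rewrite -(pre_inj (conn_base bq' (conn_sym pq))).
- by right; apply: conn_trans pq qr.
Qed.

Lemma eqst_prefix p p' a r r' : eqst p p' -> X (p ++ a :: r) ->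
  X (p' ++ a :: r') -> conn (pre p) (pre p').
Proof.
have nb q t : base q -> X (q ++ a :: t) -> q = [::].
  by case=> // Xq /(bifix_cat Xq).
by case=> // -[bp bp'] /(nb _ _ bp) -> /(nb _ _ bp') ->; exact: conn_refl.
Qed.

(** Determinism. The neighbours [a :: r] and [a :: r'] of [p] and [p'] are connected; shifting [a]
    to the left connects [r] with [r'], which are adjacent to [rcons p a] and [rcons p' a]. If [r]
    is empty, so is [r'], and both words are in X. *)
Lemma eqst_rcons p p' a r r' : eqst p p' -> X (p ++ a :: r) ->
  X (p' ++ a :: r') -> eqst (rcons p a) (rcons p' a).
Proof.
move=> epp' Xp Xp'; have cpp' := eqst_prefix epp' Xp Xp'.
have [->|npp'] := eqVneq p p'; first exact: eqst_refl.
have pn : p <> [::].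
  by move=> p0; case/eqP: npp'; apply/pre_inj/conn_base => //; left.
have pn' : p' <> [::].
  by move=> p0; case/eqP: npp'; apply/esym/pre_inj/conn_base/conn_sym => //; left.
have crr' : conn (false, a :: r) (false, a :: r').
  apply: (@conn_trans (pre p)); first by apply/conn_sym/conn1/inc_preE.
  by apply: conn_trans cpp' _; apply/conn1/inc_preE.
have crr : r = r' \/ conn (false, r) (false, r').
  have [->|nrr] := eqVneq r r'; first by left.
  right; apply: (conn_shift (b := false) (a := a) crr') => //.
  - by case=> e; rewrite e eqxx in nrr.
  - by apply/trunc_letterP; exists r.
  - by apply/trunc_letterP; exists r'.
have iso x : conn (false, [::]) x -> (false, [::]) = x.
  by move/conn_isolated; apply.
have [r0|rn] := eqVneq r [::].
  have r0' : r' = [::] by case: crr => [<- //|]; rewrite r0 => /iso[].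
  by left; split; right; rewrite -cats1; [rewrite r0 in Xp|rewrite r0' in Xp'].
have rn' : r' <> [::].
  case: crr => [<-|]; first exact/eqP.
  by move=> + r0'; rewrite r0' => /conn_sym/iso[] r0; rewrite -r0 in rn.
right; apply: (@conn_trans (false, r)).
  by apply/conn1/inc_preE; rewrite cat_rcons; split=> //; [case: (p)|exact/eqP].
apply: (@conn_trans (false, r')); first by case: crr => [->|//]; exact: conn_refl.
by apply/conn_sym/conn1/inc_preE; rewrite cat_rcons; split=> //; case: (p').
Qed.

(** Codeterminism, by shifting [a] to the right. If both words are in X, then [p] and [p'] share the
    neighbour [[:: a]], unless one is empty and the suffix code property makes them equal. *)
Lemma eqst_rcons_inv p p' a : eqst (rcons p a) (rcons p' a) -> eqst p p'.
Proof.
have [->|npp'] := eqVneq p p'; first by move=> _; exact: eqst_refl.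
have Xr q : base (rcons q a) -> X (rcons q a) by case=> //; case: q.
case=> [[/Xr Xp /Xr Xp']|c]; last first.
  right; move: (conn_shift (b := true) (a := a) c).
  rewrite /pre !rev_rcons; apply.
  - by move=> [] /(can_inj revK) e; rewrite e eqxx in npp'.
  - by apply/trunc_letterP; eexists.
  - by apply/trunc_letterP; eexists.
have nX0 q q' : X (rcons q a) -> X (rcons q' a) -> q = [::] -> q = q'.
  case: bX => _ _ sX Xq Xq' q0; have := sX _ _ Xq Xq'.
  rewrite {1}q0 -[rcons q' a]cats1 suffix_suffix cats1 => /(_ isT).
  by move/rcons_inj => [].
right; apply: (@conn_trans (false, [:: a])).
  apply/conn1/inc_preE; rewrite cats1; split=> // p0.
  by case/eqP: npp'; apply: nX0 Xp Xp' p0.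
apply/conn_sym/conn1/inc_preE; rewrite cats1; split=> // p0.
by case/eqP: npp'; apply/esym; apply: nX0 Xp' Xp p0.
Qed.

(** Prolong a simple path from [p] to [p'] by the right contexts [[:: a]] before and [a :: r] after;
    the first new edge lies only in the graph of S. By [no_excursion] the neighbour [v] of [p] on
    the path starts with [a]. *)
Lemma eqst_extend p p' a r : ~ X p -> eqst p p' -> X (p' ++ a :: r) ->
  S (rcons p a) -> exists r0, X (p ++ a :: r0).
Proof.
move=> nXp epp' Xp' Spa.
have cpp' : conn (pre p) (pre p').
  case: epp' => // -[[->|//] [->|Xp0]]; first exact: conn_refl.
  by have := bifix_cat Xp0 Xp'.
have [e|npp'] := eqVneq p p'; first by exists r; rewrite e.
have [s [ps us ls]] := conn_uniq cpp'.
case: s ps us ls => [|[d v] s] ps us ls.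
  by case/eqP: npp'; exact: pre_inj.
have iv : inc X (pre p) (d, v) by case/andP: ps.
have d0 : d = false by move: iv => /and3P[_ _ /gext_side] /=; case: d {ps us ls}.
subst d; have /inc_preE[_ _ Xpv] := iv.
suff /trunc_letterP[r0 [ev]] : trunc (false, [:: a]) (false, v).
  by exists r0; rewrite -ev.
apply: (no_excursion (S := S) (w := [::]) (x := (false, [:: a]))
  (t := pre p :: (false, v) :: s) (l := (false, a :: r))) => //.
- apply/andP; split.
    by rewrite gext_sym /gext /glue /= revK cats1; apply/asboolP.
  change (path (gext S [::]) (pre p) (rcons ((false, v) :: s) (false, a :: r))).
  rewrite rcons_path (inc_path_sub XS ps) ls /gext /glue /= revK.
  by apply/asboolP; exact: XS.
- exact: trunc_refl.
- by apply/trunc_letterP; exists r.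
- exact: inc_path_antichain ps us.
- by apply: inc_nonempty ps _.
- by rewrite !inE eqxx orbT.
Qed.

(** * Runs of the automaton on signed words *)

Definition step a p q :=
  exists p1 r, [/\ X (p1 ++ a :: r), eqst p p1 & eqst (rcons p1 a) q].

Definition sstep (x : A * bool) p q := if x.2 then step x.1 p q else step x.1 q p.

Lemma step_eqst a p p' q q' : eqst p' p -> eqst q q' -> step a p q -> step a p' q'.
Proof.
move=> ep eq [p1 [r [X1 e1 e2]]]; exists p1, r; split=> //.
  exact: eqst_trans ep e1.
exact: eqst_trans e2 eq.
Qed.

Lemma step_det a p q q' : step a p q -> step a p q' -> eqst q q'.
Proof.
move=> [p1 [r [X1 e1 e1']]] [p2 [r' [X2 e2 e2']]].
apply: eqst_trans (eqst_sym e1') _; apply: eqst_trans e2'.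
by apply: eqst_rcons X1 X2; apply: eqst_trans e2; exact: eqst_sym.
Qed.

Lemma step_codet a p p' q : step a p q -> step a p' q -> eqst p p'.
Proof.
move=> [p1 [r [X1 e1 e1']]] [p2 [r' [X2 e2 e2']]].
apply: eqst_trans e1 _; apply: eqst_trans (eqst_sym e2).
by apply: (@eqst_rcons_inv _ _ a); apply: eqst_trans e1' _; exact: eqst_sym.
Qed.

Lemma sstep_eqst (x : A * bool) p p' q q' :
  eqst p' p -> eqst q q' -> sstep x p q -> sstep x p' q'.
Proof.
by rewrite /sstep; case: x.2 => ep eq; apply: step_eqst => //; exact: eqst_sym.
Qed.

Lemma sstep_inv (x : A * bool) p q : sstep (letter_inv x) p q <-> sstep x q p.
Proof. by rewrite /sstep /letter_inv /=; case: x.2. Qed.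

Lemma sstep_back (x : A * bool) p q r :
  sstep x p q -> sstep (letter_inv x) q r -> eqst p r.
Proof.
move=> xpq /sstep_inv; move: xpq; rewrite /sstep.
case: x.2 => h h'; first exact: step_codet h h'.
exact: step_det h h'.
Qed.

Fixpoint run (w : seq (A * bool)) p q :=
  if w is x :: w' then exists2 t, sstep x p t & run w' t q else eqst p q.

Lemma run_eqst (w : seq (A * bool)) p p' q q' :
  eqst p' p -> eqst q q' -> run w p q -> run w p' q'.
Proof.
elim: w p p' => [|x w IH] p p' ep eq /=.
  by move=> epq; apply: eqst_trans ep _; apply: eqst_trans epq eq.
case=> t h1 h2; exists t; last exact: IH (eqst_refl _) eq h2.
exact: sstep_eqst ep (eqst_refl _) h1.
Qed.

Lemma run_cat (w w' : seq (A * bool)) p q r :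
  run w p q -> run w' q r -> run (w ++ w') p r.
Proof.
elim: w p => [|x w IH] p /=.
  by move=> e; apply: run_eqst => //; exact: eqst_refl.
by case=> t h1 h2 h3; exists t => //; exact: IH h3.
Qed.

Lemma run_word_inv (w : seq (A * bool)) p q : run w p q -> run (word_inv w) q p.
Proof.
elim: w p => [|x w IH] p /=; first exact: eqst_sym.
case=> t h1 /IH h2; rewrite /word_inv /= rev_cons -cats1.
apply: run_cat h2 _; exists p; first exact/sstep_inv.
exact: eqst_refl.
Qed.

(** When a letter cancels, (co)determinism brings the run back to an equivalent state. *)
Lemma run_red_cat (w w' : seq (A * bool)) p q r :
  run w p q -> run w' q r -> run (red_cat w w') p r.
Proof.
elim: w p => [|x w IH] p /=.
  by move=> e; apply: run_eqst => //; exact: eqst_refl.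
case=> t h1 h2 /(IH _ h2); case: (red_cat w w') => [|y v] /=; first by exists t.
case: eqP => [->|_] /=; last by exists t.
case=> t' h3; apply: run_eqst; last exact: eqst_refl.
exact: sstep_back h1 h3.
Qed.

(** * Positive words and the submonoid generated by X *)

Definition pos w : seq (A * bool) := [seq (a, true) | a <- w].

Lemma run_prefix p w : X (p ++ w) -> run (pos w) p (p ++ w).
Proof.
elim: w p => [|a w IH] p; first by rewrite cats0 => _; exact: eqst_refl.
move=> Xp; rewrite -cat_rcons; exists (rcons p a); last by apply: IH; rewrite cat_rcons.
by exists p, w; split=> //; exact: eqst_refl.
Qed.

(** The elements labelling a loop at the initial state form a subgroup containing X. *)
Lemma run_generated g : generated_subgroup (@fg_word A @` X) g ->
  run (fg_val g) [::] [::].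
Proof.
move=> gen; apply: (gen [set h | run (fg_val h) [::] [::]]); split.
  split=> [|h k rh rk|h]; first exact: eqst_refl.
  - exact: run_red_cat rh rk.
  - exact: run_word_inv.
move=> _ [x Xx <-]; rewrite /= fg_word_val.
apply: run_eqst (eqst_refl _) _ (run_prefix (p := [::]) Xx).
by left; split; [right|left].
Qed.

Lemma star_cat u w : X u -> star X w -> star X (u ++ w).
Proof.
move=> Xu [us Xus <-]; exists (u :: us) => // v; rewrite inE => /predU1P[-> //|].
exact: Xus.
Qed.

(** [p] is the part of the current factor already read. Once it is completed to a word of X, the run
    restarts from the empty word, which is the same state. *)
Lemma run_star p w : ~ X p -> S (p ++ w) -> run (pos w) p [::] -> star X (p ++ w).
Proof.
have nX0 : ~ X [::] by case: bX => n0 _ _ /n0.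
have fS : factorial_set S by case: aS => [[]].
elim: w p => [|a w IH] p nXp Spw /=.
  case=> [[[->|//] _]|]; first by exists [::].
  move/conn_sym/conn_base => /(_ (or_introl erefl))/pre_inj <-.
  by exists [::].
case=> q [p1 [r [X1 e1 e2]]] rq.
have Spa : S (rcons p a).
  by apply: (fS [::] _ w); rewrite /= cat_rcons.
have [r0 X0] := eqst_extend nXp e1 X1 Spa.
have {}rq : run (pos w) (rcons p a) [::].
  apply: run_eqst rq; last exact: eqst_refl.
  by apply: eqst_trans e2; exact: eqst_rcons e1 X0 X1.
rewrite -cat_rcons; have [Xpa|nXpa] := pselect (X (rcons p a)); last first.
  by apply: IH => //; rewrite cat_rcons.
apply: star_cat => //; apply: (IH [::]) => //.
  by apply: (fS (rcons p a) _ [::]); rewrite cats0 cat_rcons.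
by apply: run_eqst (eqst_refl _) rq; left; split; [left|right].
Qed.

End BifixCode.
End ExtensionGraphs.

Lemma star_subgroup_words (A : choiceType) (X : set (seq A)) :
  star X `<=` subgroup_words X.
Proof.
move=> _ [us Xus <-] H [[H1 HM _] HX].
elim: us Xus => [|u us IH] Xus; first by rewrite /= /fg_word big_nil.
rewrite /= fg_word_cat; apply: HM.
  by apply: HX; exists u => //; apply: Xus; rewrite mem_head.
by apply: IH => v vus; apply: Xus; rewrite inE vus orbT.
Qed.

Theorem theorem5p2 (A : finType) (S X : set (seq A)) (hA : 0 < #|A|)
    (hS : acyclic_set S) (hXS : X `<=` S) (hX : bifix_code X) :
  saturated_in S X.
Proof.
apply/seteqP; split=> w [].
  by move=> /star_subgroup_words.
move=> /(run_generated hS hXS hX); rewrite fg_word_val => rw Sw; split=> //.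
apply: (run_star hS hXS hX (p := [::])) => //.
by case: hX => n0 _ _ /n0.
Qed.
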